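(* Let $G$ be a countable group, $(G,X,\mu)$ a $G$-system, and $S\subset G$ a generating set of $G$. If $\alpha,\beta\in\mathcal P$ are generating partitions of $(G,X,\mu)$, then for every $\epsilon>0$ there exists $\alpha'\in\mathcal P$ such that $\alpha'$ is $S$-equivalent to $\alpha$ and $d(\alpha',\beta)<\epsilon$.
   Context: A $G$-system is a measure-preserving action of $G$ on a probability space $(X,\mu)$. $\mathcal P$ is the set of measurable partitions of $X$ into at most countably many atoms with finite entropy $H(\alpha)=-\sum_{A\in\alpha}\mu(A)\log\mu(A)$, identified modulo null sets. The Rohlin distance is $d(\alpha,\beta)=H(\alpha|\beta)+H(\beta|\alpha)$, where $H(\cdot|\cdot)$ is conditional entropy; $G$ acts on $\mathcal P$ by $g\alpha=\{gA:A\in\alpha\}$. $\alpha\vee\beta=\{A\cap B\}$; $\beta\le\alpha$ ($\alpha$ refines $\beta$) means every atom of $\alpha$ is contained up to a null set in an atom of $\beta$. For finite $F\subset G$, $\alpha^F=\bigvee_{g\in F}g\alpha$. The left Cayley graph of $(G,S)$ has vertex set $G$ and a directed edge from $g$ to $sg$ for each $g\in G$, $s\in S$; a set $F\subset G$ is $S$-connected if its induced subgraph is connected as an undirected graph. Partitions $\alpha,\beta\in\mathcal P$ are $S$-equivalent if there are finite $S$-connected sets $F_1,F_2\subset G$ containing the identity $e$ with $\alpha\le\beta^{F_1}$ and $\beta\le\alpha^{F_2}$. A partition $\alpha$ is generating if every measurable set agrees up to a null set with a set in the smallest $G$-invariant $\sigma$-algebra containing the atoms of $\alpha$. *)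

(* Defs.v *)
From HB Require Import structures.
From mathcomp Require Import all_boot all_order all_algebra.
From mathcomp Require Import all_classical all_reals all_analysis.
Set Implicit Arguments. Unset Strict Implicit. Unset Printing Implicit Defensive.
Import Order.TTheory GRing.Theory Num.Theory.
Local Open Scope classical_set_scope.
Local Open Scope ring_scope.

Definition is_group (G : Type) (mul : G -> G -> G) (inv : G -> G) (e : G) : Prop :=
  [/\ (forall x y z, mul x (mul y z) = mul (mul x y) z),
      (forall x, mul e x = x /\ mul x e = x) &
      (forall x, mul (inv x) x = e /\ mul x (inv x) = e)].

Definition generates (G : Type) (mul : G -> G -> G) (inv : G -> G) (e : G)
    (S : set G) : Prop :=
  forall H : set G, H e -> (forall x y, H x -> H y -> H (mul x y)) ->
    (forall x, H x -> H (inv x)) -> S `<=` H -> H = setT.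

Definition cayley_adj (G : Type) (mul : G -> G -> G) (S : set G) (x y : G) : Prop :=
  exists2 s, S s & (y = mul s x \/ x = mul s y).

Definition S_connected (G : Type) (mul : G -> G -> G) (S : set G) (F : set G) : Prop :=
  forall x y, F x -> F y ->
    exists (n : nat) (p : nat -> G),
      [/\ p 0%N = x, p n = y, (forall k, (k <= n)%N -> F (p k)) &
          (forall k, (k < n)%N -> cayley_adj mul S (p k) (p k.+1))].

Section Sys.
Context (G : Type) (R : realType) (d : measure_display) (X : measurableType d).

Definition is_mp_action (mul : G -> G -> G) (e : G) (mu : probability X R)
    (act : G -> X -> X) : Prop :=
  [/\ (forall x, act e x = x),
      (forall g h x, act (mul g h) x = act g (act h x)),
      (forall g, measurable_fun setT (act g)) &
      (forall g A, measurable A -> mu (act g @^-1` A) = mu A)].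

(* g A = { g x : x in A } = (act g^-1)^{-1}(A)  (for an action). *)
Definition transl (inv : G -> G) (act : G -> X -> X) (g : G) (A : set X) : set X :=
  act (inv g) @^-1` A.

(* A partition with at most countably many atoms is encoded as alpha : nat -> set X
   (atoms alpha i; padding with empty atoms is allowed). *)
Definition eta (t : R) : R := if t == 0 then 0 else - (t * ln t).

Definition entropy (mu : probability X R) (alpha : nat -> set X) : \bar R :=
  (\sum_(i <oo) (eta (fine (mu (alpha i))))%:E)%E.

Definition cond_term (mu : probability X R) (A B : set X) : R :=
  let p := fine (mu (A `&` B)) in
  let q := fine (mu B) in
  if p == 0 then 0 else p * (ln q - ln p).

Definition cond_entropy (mu : probability X R) (alpha beta : nat -> set X) : \bar R :=
  (\sum_(i <oo) \sum_(j <oo) (cond_term mu (alpha i) (beta j))%:E)%E.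

Definition rohlin_dist (mu : probability X R) (alpha beta : nat -> set X) : \bar R :=
  (cond_entropy mu alpha beta + cond_entropy mu beta alpha)%E.

Definition in_P (mu : probability X R) (alpha : nat -> set X) : Prop :=
  [/\ (forall i, measurable (alpha i)),
      (forall i j, i <> j -> alpha i `&` alpha j = set0),
      \bigcup_i alpha i = setT &
      (entropy mu alpha < +oo)%E].

(* beta <= alpha^F  (alpha^F refines beta), F finite:
   every atom  \bigcap_{g in F} g (alpha (c g))  of alpha^F is contained up to a
   null set in some atom of beta. *)
Definition refined_by_join (inv : G -> G) (act : G -> X -> X) (mu : probability X R)
    (beta alpha : nat -> set X) (F : set G) : Prop :=
  forall c : G -> nat, exists j,
    mu ((\bigcap_(g in F) transl inv act g (alpha (c g))) `\` beta j) = 0%E.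

Definition S_equivalent (mul : G -> G -> G) (inv : G -> G) (e : G)
    (act : G -> X -> X) (mu : probability X R) (S : set G)
    (alpha beta : nat -> set X) : Prop :=
  exists F1 F2 : set G,
    [/\ finite_set F1 /\ finite_set F2,
        S_connected mul S F1 /\ S_connected mul S F2,
        F1 e /\ F2 e,
        refined_by_join inv act mu alpha beta F1 &
        refined_by_join inv act mu beta alpha F2].

Definition G_invariant (inv : G -> G) (act : G -> X -> X) (M : set (set X)) : Prop :=
  forall g A, M A -> M (transl inv act g A).

Definition inv_sigma (inv : G -> G) (act : G -> X -> X) (alpha : nat -> set X)
    : set (set X) :=
  smallest (fun M => sigma_algebra setT M /\ G_invariant inv act M) (range alpha).

Definition generating (inv : G -> G) (act : G -> X -> X) (mu : probability X R)
    (alpha : nat -> set X) : Prop :=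
  forall A, measurable A -> exists2 B, inv_sigma inv act alpha B &
    mu ((A `\` B) `|` (B `\` A)) = 0%E.

End Sys.

(* Main.v *)
Require Import Defs.
From HB Require Import structures.
From mathcomp Require Import all_boot all_order all_algebra.
From mathcomp Require Import all_classical all_reals all_analysis.
From mathcomp Require Import measurable_realfun ring lra zify.
Set Implicit Arguments. Unset Strict Implicit. Unset Printing Implicit Defensive.
Import Order.TTheory GRing.Theory Num.Theory.
Local Open Scope classical_set_scope.
Local Open Scope ring_scope.

(** Write the partitions as the fibres of functions [a, b : X -> nat]. Since [beta] is
    generating, [a] agrees off a small set with some [f = phi (b (h^-1 x))_(h in s)], [s]
    finite. Since [alpha] is generating, a truncation of [b] agrees off a tiny set with a
    function [g] of finitely many translates of [a], and then [f' = phi (g (h^-1 x))_(h in s)]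
    still agrees with [a] off a small set. Let [xi] be [0] where [f' = a] and [a + 1]
    elsewhere: [alpha'] is the partition into the fibres of [(g, xi)]. It is a function of
    finitely many translates of [a], and it recovers [a] from [f'] and [xi]; finite sets of
    translates lie in finite connected ones because [S] generates [G].

    The Rohlin distance is estimated by Gibbs' inequality: [H(alpha | beta)] is at most the
    cross entropy of any guess [k i j] for the probability of atom [i] given atom [j].
    With guesses that put weight [1 - c] on the likely value and spread the weight [c]
    according to the masses of the original atoms, the cost is [- ln (1 - c)] plus the
    integral of the information functions over small sets, which is small by absolute
    continuity. *)

(** * Connected sets in the Cayley graph *)

Section Cayley.
Context (G : Type) (mul : G -> G -> G) (inv : G -> G) (e : G) (S : set G).
Hypothesis HG : is_group mul inv e.

(** Repeats the body of [S_connected], so that [S_connected mul S F] unfolds to [joined F x y] for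
    all [x], [y] in [F]. *)
Definition joined (F : set G) (x y : G) : Prop :=
  exists (n : nat) (p : nat -> G),
    [/\ p 0%N = x, p n = y, (forall k, (k <= n)%N -> F (p k)) &
        (forall k, (k < n)%N -> cayley_adj mul S (p k) (p k.+1))].

Lemma joined_trans F x y z : joined F x y -> joined F y z -> joined F x z.
Proof.
move=> [n [p [p0 pn pF pA]]] [m [q [q0 qm qF qA]]].
(* At index [n] the path still reads [p n], which equals [q 0]. *)
exists (n + m)%N, (fun k => if (k <= n)%N then p k else q (k - n)%N); split.
- by [].
- case: leqP => [mn|]; last by rewrite addKn.
  have m0 : m = 0%N by lia.
  by subst m; rewrite addn0 pn -q0 qm.
- by move=> k kn; case: leqP => kn'; [exact: pF | apply: qF; lia].
- move=> k kn; case: (ltngtP k n) => kn'.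
  + exact: pA.
  + by rewrite subSn 1?ltnW//; apply: qA; lia.
  + by subst k; rewrite subSnn pn -q0; apply: qA; lia.
Qed.

Lemma joined_sym F x y : joined F x y -> joined F y x.
Proof.
move=> [n [p [p0 pn pF pA]]].
exists n, (fun k => p (n - k)%N); split.
- by rewrite subn0.
- by rewrite subnn.
- by move=> k kn; apply: pF; lia.
- move=> k kn; have [|s Ss H] := pA (n - k.+1)%N; first by lia.
  rewrite (_ : (n - k)%N = (n - k.+1).+1); last by lia.
  by exists s => //; case: H; [right|left].
Qed.

Lemma joined_sub F F' x y : F `<=` F' -> joined F x y -> joined F' x y.
Proof.
by move=> FF' [n [p [p0 pn pF pA]]]; exists n, p; split => // k /pF /FF'.
Qed.

Lemma S_connected_setU F F' z : F z -> F' z ->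
  S_connected mul S F -> S_connected mul S F' -> S_connected mul S (F `|` F').
Proof.
move=> Fz F'z cF cF' x y Ux Uy.
have toz w : (F `|` F') w -> joined (F `|` F') w z.
  move=> [Fw|F'w].
    by apply: (@joined_sub F); [left | exact: cF].
  by apply: (@joined_sub F'); [right | exact: cF'].
exact: joined_trans (toz x Ux) (joined_sym (toz y Uy)).
Qed.

(** Edges multiply by generators on the left, so right multiplication by [z] preserves them. *)
Lemma S_connected_rmul F z :
  S_connected mul S F -> S_connected mul S ((mul^~ z) @` F).
Proof.
have [mulA _ _] := HG.
move=> cF _ _ [x Fx <-] [y Fy <-].
have [n [p [p0 pn pF pA]]] := cF _ _ Fx Fy.
exists n, (fun k => mul (p k) z); split.
- by rewrite p0.
- by rewrite pn.
- by move=> k kn; exists (p k) => //; exact: pF.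
- move=> k /pA[s Ss [->|->]]; exists s => //; rewrite mulA; by [left|right].
Qed.

(** The elements that share a finite connected set with [e] form a subgroup containing [S]. *)
Lemma S_connected_hull1 g : generates mul inv e S ->
  exists F, [/\ finite_set F, S_connected mul S F, F e & F g].
Proof.
have [mulA mul1 mulV] := HG => gen.
pose H g := exists F, [/\ finite_set F, S_connected mul S F, F e & F g].
suff HT : [set g | H g] = setT by have : [set g | H g] g by rewrite HT.
have conn1 x : S_connected mul S [set x].
  move=> _ _ -> ->; exists 0%N, (fun=> x); split => //.
have He : H e by exists [set e].
apply: gen => //.
- move=> x y [F [fF cF Fe Fx]] [F' [fF' cF' F'e F'y]].
  (* The right translate of [F] by [y] contains [mul x y], and it meets [F'] in [y] because [F]
     contains [e]. *)
  exists (F' `|` (mul^~ y) @` F); split.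
  + by rewrite finite_setU; split => //; exact: finite_image.
  + apply: (@S_connected_setU _ _ y) => //; last exact: S_connected_rmul.
    by exists e => //; case: (mul1 y).
  + by left.
  + by right; exists x.
(* Right translation by [inv x] carries [x] to [e] and [e] to [inv x]. *)
- move=> x [F [fF cF Fe Fx]]; exists ((mul^~ (inv x)) @` F); split.
  + exact: finite_image.
  + exact: S_connected_rmul.
  + by exists x => //; case: (mulV x).
  + by exists e => //; case: (mul1 (inv x)).
- move=> s Ss; exists ([set e] `|` [set s]); split; last 2 first.
  + by left.
  + by right.
  + by rewrite finite_setU; split.
  have es : joined ([set e] `|` [set s]) e s.
    exists 1%N, (fun k => if k is 0%N then e else s); split => //.
    + by move=> [_|k _]; [left|right].
    + by move=> [_|//]; exists s => //; left; case: (mul1 s).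
  have triv x : ([set e] `|` [set s]) x -> joined ([set e] `|` [set s]) x x.
    by move=> Fx; exists 0%N, (fun=> x); split.
  move=> x y [->|->] [->|->].
  + by apply: triv; left.
  + exact: es.
  + exact: joined_sym.
  + by apply: triv; right.
Qed.

End Cayley.

Lemma S_connected_hull (G : eqType) (mul : G -> G -> G) (inv : G -> G) (e : G)
    (S : set G) (s : seq G) : is_group mul inv e -> generates mul inv e S ->
  exists F, [/\ finite_set F, S_connected mul S F, F e & [set` s] `<=` F].
Proof.
move=> HG gen; elim: s => [|g s [F [fF cF Fe sF]]].
  have [F [? ? ? _]] := S_connected_hull1 HG e gen.
  by exists F; split => // x; rewrite /= in_nil.
have [F' [fF' cF' F'e F'g]] := S_connected_hull1 HG g gen.
exists (F `|` F'); split.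
- by rewrite finite_setU; split.
- exact: (@S_connected_setU _ _ _ _ _ e).
- by left.
- by move=> x /=; rewrite in_cons => /orP[/eqP ->|xs]; [right|left; exact: sF].
Qed.

(** * Discrete functions on a probability space *)

Section Fibers.
Context (d : measure_display) (X : measurableType d).

(** An arbitrary set of values is a countable union of points. *)
Lemma measurable_preimage_countable (T : countType) (f : X -> T) (A : set T) :
  (forall t, measurable (f @^-1` [set t])) -> measurable (f @^-1` A).
Proof.
move=> mf; have -> : f @^-1` A = \bigcup_(t in A) f @^-1` [set t].
  by apply/seteqP; split => [x Ax|x [t At /= fx]]; [exists (f x)|rewrite /= fx].
rewrite bigcup_mkcond; apply: countable_bigcupT_measurable => [|t].
  exact: countableP.
by case: ifP.
Qed.

Lemma measurable_comp_fibers (T : countType) (f : X -> T)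
    (d' : measure_display) (Y : measurableType d') (h : T -> Y) :
  (forall t, measurable (f @^-1` [set t])) -> measurable_fun setT (h \o f).
Proof.
by move=> mf _ B _; rewrite setTI; exact: (measurable_preimage_countable (h @^-1` B) mf).
Qed.

Lemma measurable_fiber_pair (T T' : countType) (f : X -> T) (g : X -> T') :
  (forall t, measurable (f @^-1` [set t])) ->
  (forall t, measurable (g @^-1` [set t])) ->
  forall t, measurable ((fun x => (f x, g x)) @^-1` [set t]).
Proof.
move=> mf mg [t t'].
rewrite (_ : _ @^-1` _ = f @^-1` [set t] `&` g @^-1` [set t']).
  exact: measurableI.
by apply/seteqP; split => [x [<- <-]|x [/= <- <-]].
Qed.

End Fibers.

(** * Masses as real numbers *)

Section Mass.
Context (d : measure_display) (X : measurableType d) (R : realType).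
Variable mu : probability X R.

Definition mass (A : set X) : R := fine (mu A).

Lemma massE A : measurable A -> mu A = (mass A)%:E.
Proof. by move=> mA; rewrite fineK// fin_num_measure. Qed.

Lemma mass_ge0 A : 0 <= mass A.
Proof. exact: fine_ge0. Qed.

Lemma mass_le1 A : measurable A -> mass A <= 1.
Proof. by move=> mA; rewrite -lee_fin -massE//; exact: probability_le1. Qed.

Lemma le_mass A B : measurable A -> measurable B -> A `<=` B -> mass A <= mass B.
Proof.
by move=> mA mB AB; rewrite -lee_fin -!massE// le_measure// inE.
Qed.

Lemma massU A B : measurable A -> measurable B ->
  mass (A `|` B) <= mass A + mass B.
Proof.
move=> mA mB; rewrite -lee_fin EFinD -!massE//; last exact: measurableU.
exact: measureU2.
Qed.

Lemma mass_bigsetU (I : Type) (s : seq I) (F : I -> set X) :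
  (forall i, measurable (F i)) ->
  mass (\big[setU/set0]_(i <- s) F i) <= \sum_(i <- s) mass (F i).
Proof.
move=> mF; elim: s => [|i s IH]; first by rewrite !big_nil /mass measure0.
rewrite !big_cons; apply: le_trans (massU _ _) _ => //.
  exact: bigsetU_measurable.
by rewrite lerD2l.
Qed.

(** Continuity from above: the remainders decrease to the empty set. *)
Lemma mass_tail (F : nat -> set X) (A : set X) (r : R) :
  (forall i, measurable (F i)) -> measurable A -> A `<=` \bigcup_i F i -> 0 < r ->
  exists n, mass (A `\` \big[setU/set0]_(i < n) F i) < r.
Proof.
move=> mF mA AF r0.
pose D n := A `\` \big[setU/set0]_(i < n) F i.
have mD n : measurable (D n).
  by apply: measurableD => //; exact: bigsetU_measurable.
have : mu \o D @ \oo --> mu (\bigcap_n D n).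
  apply: nonincreasing_cvg_mu => //.
  - by rewrite /= massE ?ltry.
  - exact: bigcapT_measurable.
  - apply/nonincreasing_seqP => n; apply/subsetPset; rewrite /D big_ord_recr /=.
    by apply: setDS => x; left.
have -> : \bigcap_n D n = set0.
  rewrite -subset0 => x Dx; have [Ax _] := Dx 0%N I; have [n _ Fn] := AF _ Ax.
  have [_] := Dx n.+1 I; apply; rewrite -bigcup_mkord.
  by exists n => /=.
rewrite measure0 => /fine_cvgP[_] /cvgrPdist_lt /(_ _ r0) [n _ /(_ n (leqnn n))] /=.
by rewrite sub0r normrN ger0_norm ?fine_ge0// => h; exists n.
Qed.

End Mass.

(** * Entropy and cross entropy *)

Section Entropy.
Context (d : measure_display) (X : measurableType d) (R : realType).
Variable mu : probability X R.

Definition fibers (f : X -> nat) (i : nat) : set X := f @^-1` [set i].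

Definition measurable_fibers (f : X -> nat) := forall i, measurable (fibers f i).

Lemma trivIset_fibers f : trivIset setT (fibers f).
Proof. by move=> i j _ _ [x [/= <- <-]]. Qed.

Lemma bigcup_fibers f : \bigcup_i fibers f i = setT.
Proof. by apply/seteqP; split => // x _; exists (f x). Qed.

Lemma measurable_rel2 (f g : X -> nat) (P : nat -> nat -> Prop) :
  measurable_fibers f -> measurable_fibers g -> measurable [set x | P (f x) (g x)].
Proof.
move=> mf mg.
apply: (@measurable_preimage_countable _ _ _ (fun x => (f x, g x)) [set p | P p.1 p.2]).
exact: measurable_fiber_pair.
Qed.

Lemma measurable_fun_fibers2 (f g : X -> nat) (h : nat -> nat -> R) :
  measurable_fibers f -> measurable_fibers g ->
  measurable_fun setT (fun x => h (f x) (g x)).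
Proof.
move=> mf mg; apply: (@measurable_comp_fibers _ _ _ (fun x => (f x, g x)) _ _
  (fun p => h p.1 p.2)); exact: measurable_fiber_pair.
Qed.

Lemma integral_fibers (f : X -> nat) (D : set X) (h : X -> \bar R) :
  measurable_fibers f -> measurable D -> measurable_fun setT h ->
  (forall x, 0 <= h x)%E ->
  (\int[mu]_(x in D) h x = \sum_(i <oo) \int[mu]_(x in D `&` fibers f i) h x)%E.
Proof.
move=> mf mD mh h0.
have {1}-> : D = \bigcup_i (D `&` fibers f i) by rewrite -setI_bigcupr bigcup_fibers setIT.
apply: ge0_integral_bigcup => //.
- by move=> k; exact: measurableI.
- by apply: measurable_funTS.
- by apply: trivIset_setIl; exact: trivIset_fibers.
Qed.

Lemma integral_eq_cst (D : set X) (h : X -> R) (c : R) : measurable D ->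
  (forall x, D x -> h x = c) -> (\int[mu]_(x in D) (h x)%:E = (c * mass mu D)%:E)%E.
Proof.
move=> mD hc; rewrite (eq_integral (cst c%:E)); last first.
  by move=> x; rewrite inE => /hc ->.
by rewrite integral_cst// EFinM -massE.
Qed.

Lemma integral_discrete (f : X -> nat) (c : nat -> R) : measurable_fibers f ->
  (forall i, 0 <= c i) ->
  (\int[mu]_x (c (f x))%:E = \sum_(i <oo) (c i * mass mu (fibers f i))%:E)%E.
Proof.
move=> mf c0; rewrite (@integral_fibers f)//.
- apply: eq_eseriesr => i _; rewrite setTI; apply: integral_eq_cst => //.
  by move=> x ->.
- by apply/measurable_EFinP; exact: (measurable_fun_fibers2 (fun i _ => c i)).
- by move=> x; rewrite lee_fin.
Qed.

Lemma integral_discrete2 (f g : X -> nat) (c : nat -> nat -> R) :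
  measurable_fibers f -> measurable_fibers g -> (forall i j, 0 <= c i j) ->
  (\int[mu]_x (c (f x) (g x))%:E =
   \sum_(i <oo) \sum_(j <oo) (c i j * mass mu (fibers f i `&` fibers g j))%:E)%E.
Proof.
move=> mf mg c0.
have mc : measurable_fun setT (fun x => (c (f x) (g x))%:E).
  by apply/measurable_EFinP; exact: measurable_fun_fibers2.
have c0' x : (0 <= (c (f x) (g x))%:E)%E by rewrite lee_fin.
rewrite (@integral_fibers f)//; apply: eq_eseriesr => i _; rewrite setTI.
rewrite (@integral_fibers g)//; apply: eq_eseriesr => j _.
apply: integral_eq_cst; first exact: measurableI.
by move=> x [/= -> ->].
Qed.

Lemma ln_le_sub1 (x : R) : 0 < x -> ln x <= x - 1.
Proof. by move=> x0; rewrite -[x in ln x](subrK 1) addrC le_ln1Dx//; lra. Qed.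

Lemma cond_term_ge0 A B : measurable A -> measurable B -> 0 <= cond_term mu A B.
Proof.
move=> mA mB; rewrite /cond_term -!/(mass mu _); case: eqP => // /eqP p0.
have mAB : measurable (A `&` B) by exact: measurableI.
have pgt0 : 0 < mass mu (A `&` B) by rewrite lt_neqAle eq_sym p0 mass_ge0.
have pq : mass mu (A `&` B) <= mass mu B by exact: le_mass.
rewrite mulr_ge0 ?mass_ge0// subr_ge0 ler_ln// posrE//; exact: lt_le_trans pq.
Qed.

(** This is [ln x <= x - 1] at [x = q * k / p], multiplied by [p], where [p] and [q] are the masses
    of the intersection and of [B]. The summands [p] and [q * k] are kept because they compare only
    after summation over all atoms. *)
Lemma cond_term_gibbs A B (k : R) : measurable A -> measurable B -> 0 <= k ->
  (k = 0 -> mass mu (A `&` B) = 0) ->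
  cond_term mu A B + mass mu (A `&` B) <= - ln k * mass mu (A `&` B) + mass mu B * k.
Proof.
move=> mA mB k0 kp; rewrite /cond_term -!/(mass mu _).
have mAB : measurable (A `&` B) by exact: measurableI.
have pq : mass mu (A `&` B) <= mass mu B by exact: le_mass.
set p := mass mu (A `&` B) in kp pq *; set q := mass mu B in pq *.
have q0 : 0 <= q by exact: mass_ge0.
case: eqP => [->|/eqP p0]; first by rewrite !addr0 mulr0 add0r mulr_ge0.
have pgt0 : 0 < p by rewrite lt_neqAle eq_sym p0 mass_ge0.
have kgt0 : 0 < k.
  by rewrite lt_neqAle k0 andbT; apply: contraNN p0 => /eqP E; rewrite kp.
have qgt0 : 0 < q by exact: lt_le_trans pq.
have x0 : 0 < q * k / p by rewrite divr_gt0// mulr_gt0.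
have := ln_le_sub1 x0; rewrite ln_div ?posrE ?mulr_gt0// lnM ?posrE// => h.
have : p * (ln q + ln k - ln p) <= p * (q * k / p - 1) by rewrite ler_pM2l.
rewrite [X in _ <= X](_ : _ = q * k - p); last by field.
by move: (ln q) (ln k) (ln p) => a b c; nra.
Qed.

Lemma sum_mass_fibers (f : X -> nat) : measurable_fibers f ->
  (\sum_(i <oo) (mass mu (fibers f i))%:E = 1)%E.
Proof.
move=> mf; rewrite -(probability_setT mu) -[in RHS](bigcup_fibers f).
rewrite measure_semi_bigcup//=; last 2 first.
- exact: trivIset_fibers.
- by rewrite bigcup_fibers.
by apply: eq_eseriesr => i _; rewrite massE.
Qed.

(* Gibbs' inequality: [k i j] is a guess for the conditional probability of [f = i]
   given [g = j], and the cross entropy of the guess dominates the conditional entropy. *)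
Lemma cond_entropy_le_cross (f g : X -> nat) (k : nat -> nat -> R) :
  measurable_fibers f -> measurable_fibers g ->
  (forall i j, 0 <= k i j <= 1) ->
  (forall j, \sum_(i <oo) (k i j)%:E <= 1)%E ->
  (forall i j, k i j = 0 -> mass mu (fibers f i `&` fibers g j) = 0) ->
  (cond_entropy mu (fibers f) (fibers g) <= \int[mu]_x (- ln (k (f x) (g x)))%:E)%E.
Proof.
move=> mf mg k01 ksum kabs.
have k0 i j : 0 <= k i j by case/andP: (k01 i j).
have k1 i j : k i j <= 1 by case/andP: (k01 i j).
have lk0 i j : 0 <= - ln (k i j) by rewrite oppr_ge0 ln_le0.
pose p i j := mass mu (fibers f i `&` fibers g j).
pose t i j := cond_term mu (fibers f i) (fibers g j).
have t0 i j : 0 <= t i j by exact: cond_term_ge0.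
have p0 i j : 0 <= p i j by exact: mass_ge0.
pose q j := mass mu (fibers g j).
have q0 j : 0 <= q j by exact: mass_ge0.
have psum : (\sum_(i <oo) \sum_(j <oo) (p i j)%:E = 1)%E.
  have := @integral_discrete2 f g (fun _ _ => 1) mf mg (fun _ _ => ler01).
  rewrite integral_cst// mul1e => h.
  transitivity (mu setT); last exact: probability_setT.
  rewrite [RHS]h.
  by apply: eq_eseriesr => i _; apply: eq_eseriesr => j _; rewrite mul1r.
(* Summing over [i] first, each column of [k] contributes at most its factor [q j], and the [q j]
   sum to 1. *)
have qksum : (\sum_(i <oo) \sum_(j <oo) (q j * k i j)%:E <= 1)%E.
  rewrite nneseries_interchange; last by move=> i j; rewrite lee_fin mulr_ge0.
  rewrite -(sum_mass_fibers mg); apply: lee_nneseries => j.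
    by move=> _ _; apply: nneseries_ge0 => i _ _; rewrite lee_fin mulr_ge0.
  move=> _; under eq_eseriesr do rewrite EFinM.
  rewrite nneseriesZl; last by move=> i _; rewrite lee_fin.
  by rewrite -[leRHS]mule1; apply: lee_wpmul2l; rewrite ?lee_fin.
(* Adding 1 to both sides makes the inequality termwise: on the left 1 is the sum of the [p i j], on
   the right it bounds the sum of the [q j * k i j]. *)
rewrite -(@leeD2rE _ 1%E)// -{1}psum /cond_entropy.
rewrite -nneseriesD; last 2 first.
- by move=> i _ _; apply: nneseries_ge0 => j _ _; rewrite lee_fin t0.
- by move=> i _ _; apply: nneseries_ge0 => j _ _; rewrite lee_fin.
rewrite (@integral_discrete2 f g (fun i j => - ln (k i j)))//.
apply: (@le_trans _ _ (\sum_(i <oo) (\sum_(j <oo) (- ln (k i j) * p i j)%:E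
    + \sum_(j <oo) (q j * k i j)%:E))%E); last first.
  rewrite nneseriesD; first by apply: leeD2l.
  - by move=> i _ _; apply: nneseries_ge0 => j _ _; rewrite lee_fin mulr_ge0.
  - by move=> i _ _; apply: nneseries_ge0 => j _ _; rewrite lee_fin mulr_ge0.
apply: lee_nneseries => [i _ _|i _].
  by apply: adde_ge0; apply: nneseries_ge0 => j _ _; rewrite lee_fin ?t0.
rewrite -!nneseriesD; try by move=> j _ _; rewrite lee_fin ?t0 ?mulr_ge0.
apply: lee_nneseries => [j _ _|j _].
  by rewrite lee_fin addr_ge0// t0.
by rewrite -!EFinD lee_fin; apply: cond_term_gibbs => //; exact: kabs.
Qed.

(** The information function of the partition; it vanishes on null fibres since [ln 0 = 0]. *)
Definition info (f : X -> nat) (x : X) : R := - ln (mass mu (fibers f (f x))).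

Lemma info_ge0 f x : measurable_fibers f -> 0 <= info f x.
Proof. by move=> mf; rewrite oppr_ge0 ln_le0// mass_le1. Qed.

Lemma measurable_info f : measurable_fibers f -> measurable_fun setT (info f).
Proof.
by move=> mf; exact: (measurable_fun_fibers2 (fun i _ => - ln (mass mu (fibers f i)))).
Qed.

Lemma integral_info f : measurable_fibers f ->
  (\int[mu]_x (info f x)%:E = entropy mu (fibers f))%E.
Proof.
move=> mf; rewrite (@integral_discrete f (fun i => - ln (mass mu (fibers f i))))//.
  apply: eq_eseriesr => i _; rewrite /Defs.eta -/(mass mu _); congr (_%:E).
  have [->|_] := eqVneq (mass mu (fibers f i)) 0; first by rewrite mulr0.
  by rewrite mulrC mulrN.
by move=> i; rewrite oppr_ge0 ln_le0// mass_le1.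
Qed.

Lemma integrable_info f (K : R) : measurable_fibers f ->
  (entropy mu (fibers f) < +oo)%E -> mu.-integrable setT (fun x => (K + info f x)%:E).
Proof.
move=> mf Hf; rewrite (_ : (fun x => _) = (cst K%:E \+ (EFin \o info f))%E)//.
apply: integrableD => //; first exact: finite_measure_integrable_cst.
apply/integrableP; split; first by apply/measurable_EFinP; exact: measurable_info.
rewrite (eq_integral (fun x => (info f x)%:E)) ?integral_info// => x _ /=.
by rewrite ger0_norm// info_ge0.
Qed.

(** Absolute continuity of the integral: [info] is integrable because its integral is the entropy.
    The constant [K] leaves room for the price [- ln c] of a wrong guess. *)
Lemma integral_info_small f (K r : R) : measurable_fibers f ->
  (entropy mu (fibers f) < +oo)%E -> 0 <= K -> 0 < r ->
  exists2 del : R, 0 < del & forall U, measurable U -> mass mu U < del ->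
    (\int[mu]_(x in U) (K + info f x)%:E < r%:E)%E.
Proof.
move=> mf Hf K0 r0; have If := integrable_info K mf Hf.
have [del [del0 H]] := integral_normr_continuous If r0.
exists del => // U mU Udel.
have Ud : (mu U < del%:E)%E by rewrite massE// lte_fin.
have := H U mU Ud.
rewrite -lte_fin /Rintegral fineK.
  rewrite (eq_integral (fun x => (K + info f x)%:E))// => x _.
  by rewrite ger0_norm// addr_ge0// info_ge0.
have /integrable_abse : mu.-integrable U (fun x => (K + info f x)%:E).
  by apply: integrableS If.
exact: integrable_fin_num.
Qed.

End Entropy.

(** Division with remainder by [K] reindexes the range by pairs, so that a kernel that is a product
    in quotient and remainder can be summed factor by factor. *)
Lemma sum_divn_modn (R : realDomainType) (F : nat -> nat -> R) (K n : nat) :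
  (0 < K)%N ->
  \sum_(0 <= i < n * K) F (i %/ K)%N (i %% K)%N =
  \sum_(0 <= l < n) \sum_(0 <= k < K) F l k.
Proof.
move=> K0; elim: n => [|n IH]; first by rewrite mul0n !big_geq.
rewrite big_nat_recr//= -IH mulSn addnC (big_cat_nat (n := n * K)) ?leq_addr//=.
congr (_ + _); rewrite -{1}[(n * K)%N]add0n big_addn addKn.
apply: eq_big_nat => k /andP[_ kK].
by rewrite addnC divnMDl// divn_small// addn0 modnMDl modn_small.
Qed.

Lemma mem_set_bool (T : Type) (P : T -> bool) x : (x \in [set x | P x]) = P x.
Proof. by apply/idP/idP; rewrite inE. Qed.

(** * Guessed distributions and their logarithmic cost *)

Section Kernels.
Context (R : realType).

(** One value of a mixture: the point mass at the likely outcome with weight [1 - c], a fallback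
    distribution with weight [c]; [u] is the fallback weight of this value. *)
Definition guess (c : R) (hit : bool) (u : R) : R := (1 - c) * hit%:R + c * u.

Lemma guess_ge0 c hit u : 0 < c < 1 -> 0 <= u -> 0 <= guess c hit u.
Proof.
move=> /andP[c0 c1] u0; rewrite /guess addr_ge0// mulr_ge0//; last exact: ltW.
by rewrite subr_ge0 ltW.
Qed.

Lemma guess_le1 c hit u : 0 < c < 1 -> 0 <= u <= 1 -> guess c hit u <= 1.
Proof. by move=> /andP[c0 c1] /andP[u0 u1]; rewrite /guess; case: hit => /=; nra. Qed.

Lemma guess_eq0 c hit u : 0 < c < 1 -> 0 <= u -> guess c hit u = 0 -> u = 0 /\ ~~ hit.
Proof. by move=> /andP[c0 c1] u0; rewrite /guess; case: hit => /=; split => //; nra. Qed.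

(** The cost [- ln (1 - c)] is charged in both cases, so that it integrates to a constant; only a
    miss pays for the fallback. *)
Lemma ln_guess c hit u : 0 < c < 1 -> 0 <= u <= 1 ->
  - ln (guess c hit u) <= - ln (1 - c) + (if hit then 0 else - ln c - ln u).
Proof.
move=> /andP[c0 c1] /andP[u0 u1]; rewrite /guess; case: hit => /=.
  rewrite addr0 mulr1 lerN2 ler_ln ?posrE; [nra|lra|nra].
have lc : 0 <= - ln c by rewrite oppr_ge0 ln_le0// ltW.
have lu : 0 <= - ln u by rewrite oppr_ge0 ln_le0.
have l1c : 0 <= - ln (1 - c) by rewrite oppr_ge0 ln_le0//; lra.
rewrite mulr0 add0r; have [->|u0'] := eqVneq u 0; first by rewrite mulr0 ln0//; lra.
have ugt0 : 0 < u by rewrite lt_neqAle eq_sym u0'.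
by rewrite lnM ?posrE//; lra.
Qed.

(** If a factor is [0], the convention [ln 0 = 0] makes the left side vanish while the right side is
    nonnegative; hence only an inequality. *)
Lemma lnM_ge (x y : R) : 0 <= x <= 1 -> 0 <= y <= 1 -> - ln (x * y) <= - ln x - ln y.
Proof.
move=> /andP[x0 x1] /andP[y0 y1].
have lx : 0 <= - ln x by rewrite oppr_ge0 ln_le0.
have ly : 0 <= - ln y by rewrite oppr_ge0 ln_le0.
have [->|x0'] := eqVneq x 0; first by rewrite mul0r ln0//; lra.
have [->|y0'] := eqVneq y 0; first by rewrite mulr0 ln0//; lra.
by rewrite lnM ?posrE ?lt_neqAle 1?eq_sym ?x0' 1?eq_sym ?y0'//; lra.
Qed.

End Kernels.

(** * Bounds on conditional entropy from explicit predictions *)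

Section Bounds.
Context (d : measure_display) (X : measurableType d) (R : realType).
Variable mu : probability X R.

(** The pointwise bound integrated, [s] being integrated over total mass 1. Where the error sets
    overlap both costs are charged. *)
Lemma integral_le_two_sets (h v w : X -> R) (V W : set X) (s : R) :
  measurable V -> measurable W -> measurable_fun setT h ->
  measurable_fun setT v -> measurable_fun setT w -> 0 <= s ->
  (forall x, 0 <= h x) -> (forall x, 0 <= v x) -> (forall x, 0 <= w x) ->
  (forall x, h x <= s + (if x \in V then v x else 0) + (if x \in W then w x else 0)) ->
  (\int[mu]_x (h x)%:E <=
   s%:E + \int[mu]_(x in V) (v x)%:E + \int[mu]_(x in W) (w x)%:E)%E.
Proof.
move=> mV mW mh mv mw s0 h0 v0 w0 H.
have mres U (u : X -> R) : measurable U -> measurable_fun setT u ->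
    measurable_fun setT ((fun x => (u x)%:E) \_ U).
  move=> mU mu'; apply/(measurable_restrictT _ mU)/measurable_funTS.
  exact/measurable_EFinP.
have res0 U (u : X -> R) : (forall x, 0 <= u x) ->
    forall x, (0 <= ((fun x => (u x)%:E) \_ U) x)%E.
  by move=> u0 x; rewrite patchE; case: ifP; rewrite ?lee_fin.
rewrite [X in (_ <= _ + X + _)%E]integral_mkcond [X in (_ <= _ + X)%E]integral_mkcond.
have -> : s%:E = (\int[mu]_x (cst s%:E) x)%E.
  by rewrite integral_cst//= -[LHS]mule1; congr (_ * _)%E; rewrite -(probability_setT mu).
rewrite -ge0_integralD//=; last 2 first.
- by move=> x _; exact: res0.
- exact: mres.
rewrite -ge0_integralD//=; last 4 first.
- by move=> x _; rewrite adde_ge0 ?lee_fin ?res0.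
- by apply: emeasurable_funD => //; exact: mres.
- by move=> x _; exact: res0.
- exact: mres.
apply: ge0_le_integral => //=.
- by move=> x _; rewrite lee_fin.
- exact/measurable_EFinP.
- by apply: emeasurable_funD; [apply: emeasurable_funD => //; exact: mres|exact: mres].
- move=> x _; have := H x; rewrite !patchE.
  by case: ifP => _; case: ifP => _; rewrite -?EFinD lee_fin.
Qed.

(* Fano's inequality: [g] predicts [f] through [t], and the wrong guesses cost
   at most the information of [f]. *)
Lemma cond_entropy_predict (f g : X -> nat) (t : nat -> nat) (c : R) :
  measurable_fibers f -> measurable_fibers g -> 0 < c < 1 ->
  (cond_entropy mu (fibers f) (fibers g) <= (- ln (1 - c))%:E +
   \int[mu]_(x in [set x | f x != t (g x)]) (- ln c + info mu f x)%:E)%E.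
Proof.
move=> mf mg c01; have [c0 c1] := andP c01.
pose u i := mass mu (fibers f i).
have u01 i : 0 <= u i <= 1 by rewrite mass_ge0 mass_le1.
have u0 i : 0 <= u i by case/andP: (u01 i).
pose k i j := guess c (i == t j) (u i).
have k0 i j : 0 <= k i j by exact: guess_ge0.
have k1 i j : k i j <= 1 by exact: guess_le1.
have s0 : 0 <= - ln (1 - c) by rewrite oppr_ge0 ln_le0//; lra.
have lc : 0 <= - ln c by rewrite oppr_ge0 ln_le0//; lra.
apply: le_trans (@cond_entropy_le_cross _ _ _ mu f g k mf mg _ _ _) _.
- by move=> i j; rewrite k0 k1.
(* The column sums to exactly 1: [1 - c] from the single hit [i = t j], and [c] from the masses of
   the fibres. *)
- move=> j; rewrite /k /guess.
  under eq_eseriesr do rewrite EFinD.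
  rewrite nneseriesD; last 2 first.
  + by move=> i _ _; rewrite lee_fin mulr_ge0// subr_ge0 ltW.
  + by move=> i _ _; rewrite lee_fin mulr_ge0// ltW.
  rewrite (nneseriesD1 (n := t j))//=; last first.
    by move=> i _; rewrite lee_fin mulr_ge0// subr_ge0 ltW.
  rewrite eseries0; last by move=> i _ /=; case: eqP; rewrite // mulr0.
  under eq_eseriesr do rewrite EFinM.
  rewrite nneseriesZl; last by move=> i _; rewrite lee_fin.
  by rewrite sum_mass_fibers// eqxx adde0 mule1 -EFinD lee_fin mulr1 subrK.
- move=> i j /(guess_eq0 c01 (u0 i))[ui _]; apply/eqP.
  rewrite eq_le mass_ge0 andbT -ui; apply: le_mass => //; exact: measurableI.
(* There is one error set only; the second is taken to be empty. *)
rewrite -[leRHS]adde0 -(integral_set0 mu (fun=> 0%:E)).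
apply: integral_le_two_sets => //.
- exact: (measurable_rel2 (fun i j => i != t j)).
- exact: (measurable_fun_fibers2 (fun i j => - ln (k i j))).
- by apply: measurable_funD => //; exact: measurable_info.
- by move=> x; rewrite oppr_ge0 ln_le0.
- by move=> x; rewrite addr_ge0// info_ge0.
move=> x; rewrite in_set0 addr0; apply: le_trans (ln_guess _ c01 (u01 _)) _.
rewrite lerD2l; case: eqP => [_|/eqP fx]; first by case: ifP => // _; rewrite addr_ge0// info_ge0.
by rewrite mem_set.
Qed.

(* [f] encodes the pair [(f %% N.+1, f %/ N.+1)]; the first component is predicted by [t]
   and otherwise guessed uniformly, the second is guessed to be [0] and otherwise to be
   [(a x).+1]. *)
Lemma cond_entropy_code (f g a : X -> nat) (t : nat -> nat) (N : nat) (c : R) :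
  measurable_fibers f -> measurable_fibers g -> measurable_fibers a -> 0 < c < 1 ->
  (forall j, (t j <= N)%N) ->
  (forall x, (f x %/ N.+1 != 0 -> f x %/ N.+1 = (a x).+1)%N) ->
  (cond_entropy mu (fibers f) (fibers g) <= (- ln (1 - c) - ln (1 - c))%:E +
   ((- ln c + ln N.+1%:R) * mass mu [set x | (f x %% N.+1)%N != t (g x)])%:E +
   \int[mu]_(x in [set x | (f x %/ N.+1)%N != 0%N]) (- ln c + info mu a x)%:E)%E.
Proof.
move=> mf mg ma c01 tN fa; have [c0 c1] := andP c01.
(* The quotient [0] is reserved for the likely case, so the law of [a] is shifted by one. *)
pose u l := if l is l'.+1 then mass mu (fibers a l') else 0.
have u01 l : 0 <= u l <= 1 by case: l => [|l] /=; rewrite ?lexx ?ler01// mass_ge0 mass_le1.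
have u0 l : 0 <= u l by case/andP: (u01 l).
have v01 : 0 <= (N.+1%:R^-1 : R) <= 1 by rewrite invr_ge0 ler0n invf_le1// ler1n.
have v0 : 0 <= (N.+1%:R^-1 : R) by case/andP: v01.
pose k1 m j := guess c (m == t j) N.+1%:R^-1.
pose k2 l := guess c (l == 0%N) (u l).
pose k i j := k1 (i %% N.+1)%N j * k2 (i %/ N.+1)%N.
have k101 m j : 0 <= k1 m j <= 1 by rewrite guess_ge0//= guess_le1.
have k10 m j : 0 <= k1 m j by case/andP: (k101 m j).
have k201 l : 0 <= k2 l <= 1 by rewrite guess_ge0//= guess_le1.
have k20 l : 0 <= k2 l by case/andP: (k201 l).
have k01 i j : 0 <= k i j <= 1.
  by rewrite mulr_ge0//= mulr_ile1//;
    [case/andP: (k101 (i %% N.+1)%N j)|case/andP: (k201 (i %/ N.+1)%N)].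
have s0 : 0 <= - ln (1 - c) by rewrite oppr_ge0 ln_le0//; lra.
have lc : 0 <= - ln c by rewrite oppr_ge0 ln_le0//; lra.
have lN : 0 <= ln (N.+1%:R : R) by rewrite ln_ge0// ler1n.
have mV : measurable [set x | (f x %% N.+1)%N != t (g x)].
  exact: (measurable_rel2 (fun i j => (i %% N.+1)%N != t j)).
have mW : measurable [set x | (f x %/ N.+1)%N != 0%N].
  exact: (measurable_rel2 (fun i j => (i %/ N.+1)%N != 0%N) mf mf).
apply: le_trans (@cond_entropy_le_cross _ _ _ mu f g k mf mg _ _ _) _ => //.
- move=> j; apply: lime_le; first by apply: is_cvg_nneseries => i _ _; rewrite lee_fin mulr_ge0.
  apply: nearW => n; rewrite sumEFin lee_fin.
  have k1sum : \sum_(0 <= m < N.+1) k1 m j = 1.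
    rewrite big_split/= -!mulr_sumr big_mkord (bigD1 (Ordinal (tN j : t j < N.+1)%N))//=.
    rewrite eqxx big1 ?addr0; last first.
      by move=> i; rewrite -val_eqE /= => /negbTE ->.
    by rewrite sumr_const_nat subn0 -[X in c * X]mulr_natr mulVf ?pnatr_eq0// !mulr1 subrK.
  have k2sum : \sum_(0 <= l < n) k2 l <= 1.
    apply: (@le_trans _ _ (\sum_(0 <= l < n.+1) k2 l)).
      by rewrite big_nat_recr//= lerDl.
    rewrite big_nat_recl//= {1}/k2 /guess /= mulr0 addr0 mulr1.
    rewrite -[leRHS](subrK c) lerD2l.
    under eq_bigr do rewrite /k2 /guess /= mulr0 add0r.
    rewrite -mulr_sumr -[leRHS]mulr1 ler_pM2l// -lee_fin -sumEFin.
    rewrite -[leRHS](sum_mass_fibers mu ma); apply: nneseries_lim_ge => i _ _.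
    by rewrite lee_fin mass_ge0.
  (* Lengthening the range to full blocks of [N.+1] makes the sum a product of the sums over
     remainders and over quotients. *)
  apply: (@le_trans _ _ (\sum_(0 <= i < n * N.+1) k i j)).
    rewrite (big_cat_nat (n := n) (p := (n * N.+1)%N)) ?leq_pmulr//= lerDl.
    by apply: sumr_ge0 => i _; rewrite mulr_ge0.
  rewrite (sum_divn_modn (fun l m => k1 m j * k2 l))//.
  under eq_bigr do rewrite -mulr_suml k1sum mul1r.
  exact: k2sum.
(* The uniform fallback keeps [k1] positive, so [k2] vanishes. Then the quotient is some [l.+1], and
   the fibre of [f] lies in a null fibre of [a]. *)
- move=> i j /eqP; rewrite mulf_eq0 => /orP[/eqP /(guess_eq0 c01 v0)[/eqP]|].
    by rewrite invr_eq0 pnatr_eq0.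
  move=> /eqP /(guess_eq0 c01 (u0 _))[].
  case E : (i %/ N.+1)%N => [|l]//= ul _; apply/eqP.
  rewrite eq_le mass_ge0 andbT -ul; apply: le_mass => //; first exact: measurableI.
  move=> x [/= fi _]; have := fa x; rewrite fi E => /(_ isT) [->].
  by [].
rewrite EFinM -massE// -integral_cst//=.
apply: integral_le_two_sets => //.
- exact: (measurable_fun_fibers2 (fun i j => - ln (k i j))).
- by apply: measurable_funD => //; exact: measurable_info.
- exact: addr_ge0.
- by move=> x; rewrite oppr_ge0 ln_le0//; case/andP: (k01 (f x) (g x)).
- by move=> x; exact: addr_ge0.
- by move=> x; rewrite addr_ge0// info_ge0.
move=> x; apply: le_trans (lnM_ge (k101 _ _) (k201 _)) _.
have := ln_guess ((f x %% N.+1)%N == t (g x)) c01 v01.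
rewrite -/(k1 _ _) lnV ?posrE// opprK mem_set_bool => h1.
have := ln_guess ((f x %/ N.+1)%N == 0%N) c01 (u01 (f x %/ N.+1)%N).
rewrite -/(k2 _) mem_set_bool => h2.
have {h2} : - ln (k2 (f x %/ N.+1)%N) <= - ln (1 - c) +
    (if (f x %/ N.+1)%N != 0%N then - ln c + info mu a x else 0).
  by apply: le_trans h2 _; case: eqP => //= /eqP /fa ->.
have {h1} : - ln (k1 (f x %% N.+1)%N (g x)) <= - ln (1 - c) +
    (if (f x %% N.+1)%N != t (g x) then - ln c + ln N.+1%:R else 0).
  by apply: le_trans h1 _; case: eqP.
by move=> h1 h2; apply: le_trans (lerD h1 h2) _; rewrite addrACA addrA.
Qed.

End Bounds.

(** * Functions of finitely many translates *)

Section Local.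
Context (G : countType) (mul : G -> G -> G) (inv : G -> G) (e : G).
Context (R : realType) (d : measure_display) (X : measurableType d).
Context (mu : probability X R) (act : G -> X -> X).
Hypothesis HG : is_group mul inv e.
Hypothesis Hact : is_mp_action mul e mu act.

(** The entry at [h] labels the atom, in the translate by [h], that contains [x]; the nonempty level
    sets are the nonempty atoms of the join over [s]. *)
Definition itinerary (f : X -> nat) (s : seq G) (x : X) : seq nat :=
  [seq f (act (inv h) x) | h <- s].

(** With [T := Prop] this says that a set is a union of atoms of the join over [s]. *)
Definition local (f : X -> nat) (s : seq G) (T : Type) (g : X -> T) : Prop :=
  forall x y, itinerary f s x = itinerary f s y -> g x = g y.

Lemma itinerary_sub f s s' x y : {subset s <= s'} ->
  itinerary f s' x = itinerary f s' y -> itinerary f s x = itinerary f s y.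
Proof.
by move=> ss' /eq_in_map E; apply/eq_in_map => h /ss'; exact: E.
Qed.

Lemma local_sub f s s' T (g : X -> T) : {subset s <= s'} -> local f s g -> local f s' g.
Proof. by move=> ss' lg x y /(itinerary_sub ss')/lg. Qed.

Lemma act_inv_mul g h x : act (inv (mul g h)) x = act (inv h) (act (inv g) x).
Proof.
have [mulA mul1 mulV] := HG; have [act1 actM _ _] := Hact.
rewrite -actM; congr (act _ x).
have -> : inv (mul g h) = mul (inv (mul g h)) (mul (mul g h) (mul (inv h) (inv g))).
  rewrite -(mulA g) (mulA h) (mulV h).2 (mul1 _).1 (mulV g).2.
  by rewrite (mul1 _).2.
by rewrite mulA (mulV _).1 (mul1 _).1.
Qed.

Lemma act_inv_e x : act (inv e) x = x.
Proof.
have [_ mul1 mulV] := HG; have [act1 _ _ _] := Hact.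
by rewrite -[inv e](mul1 _).2 (mulV e).1.
Qed.

Lemma local_self (a : X -> nat) : local a [:: e] a.
Proof. by move=> x y []; rewrite !act_inv_e. Qed.

Lemma local_transl f s T (g : X -> T) k :
  local f s g -> local f [seq mul k h | h <- s] (g \o act (inv k)).
Proof.
move=> lg x y /eq_in_map E; apply: lg; apply/eq_in_map => h hs.
by rewrite -!act_inv_mul; apply: E; exact: map_f.
Qed.

(** The entry of the [g]-itinerary at [h'] depends on [f] through the window [s] translated by [h'];
    the windows together form the product set. *)
Lemma local_bind f s s' (g : X -> nat) T (k : X -> T) : local f s g -> local g s' k ->
  local f [seq mul h' h | h' <- s', h <- s] k.
Proof.
move=> lg lk x y E; apply: lk; apply/eq_in_map => h' h's.
have /= L := @local_transl _ _ _ _ h' lg x y; apply: L; apply: itinerary_sub E => _ /mapP[h hs ->].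
by apply/allpairsP; exists (h', h).
Qed.

Lemma local_comp2 f s T1 T2 T (g1 : X -> T1) (g2 : X -> T2) (k : T1 -> T2 -> T) :
  local f s g1 -> local f s g2 -> local f s (fun x => k (g1 x) (g2 x)).
Proof. by move=> l1 l2 x y E; rewrite (l1 _ _ E) (l2 _ _ E). Qed.

Lemma measurable_act g A : measurable A -> measurable (act g @^-1` A).
Proof.
by have [_ _ mact _] := Hact => mA; rewrite -[X in measurable X]setTI; exact: mact.
Qed.

Lemma mass_act g A : measurable A -> mass mu (act g @^-1` A) = mass mu A.
Proof. by have [_ _ _ inv_mu] := Hact => mA; rewrite /mass inv_mu. Qed.

Lemma measurable_itinerary f s (w : seq nat) : measurable_fibers f ->
  measurable (itinerary f s @^-1` [set w]).
Proof.
move=> mf; elim: s w => [|h s IH] [|n w].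
- by rewrite (_ : _ @^-1` _ = setT)//; apply/seteqP; split.
- by rewrite (_ : _ @^-1` _ = set0)//; apply/seteqP; split.
- by rewrite (_ : _ @^-1` _ = set0)//; apply/seteqP; split.
- rewrite (_ : _ @^-1` _ =
    (act (inv h) @^-1` (fibers f n)) `&` (itinerary f s @^-1` [set w])).
    by apply: measurableI => //; exact: measurable_act.
  by apply/seteqP; split => [x [/= <- <-]//|x [/= <- <-]].
Qed.

(** The map [phi] of the overview. It will be fed with itineraries of another function, which [f]
    may never realise; there it takes the default [0]. *)
Definition itinerary_factor (f : X -> nat) (s : seq G) (g : X -> nat) (w : seq nat) : nat :=
  xget 0%N [set n | exists2 x, itinerary f s x = w & g x = n].

Lemma itinerary_factorP f s g : local f s g ->
  forall x, itinerary_factor f s g (itinerary f s x) = g x.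
Proof.
move=> lg x; rewrite /itinerary_factor; case: xgetP => [n _ [y E <-]|/(_ (g x)) []].
  exact: lg.
by exists x.
Qed.

(** A local set is the preimage of a set of itineraries, and finite sequences of naturals are
    countable. *)
Lemma measurable_local f s (A : set X) : measurable_fibers f ->
  local f s A -> measurable A.
Proof.
move=> mf lA.
have -> : A = itinerary f s @^-1` (itinerary f s @` A).
  by apply/seteqP; split => [x Ax|x [y Ay /lA <-]//]; exists x.
by apply: measurable_preimage_countable => w; exact: measurable_itinerary.
Qed.

Lemma measurable_local_fiber f s T (g : X -> T) (t : T) :
  measurable_fibers f -> local f s g ->
  measurable (g @^-1` [set t]).
Proof.
move=> mf lg; apply: (measurable_local mf (s := s)) => x y E.
by rewrite /preimage /= (lg _ _ E).
Qed.

(** * Approximation in measure by local sets *)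

Definition symdiff (A B : set X) : set X := (A `\` B) `|` (B `\` A).

(** Membership in the closure of the algebra of local sets for the pseudometric
    [mass mu (symdiff A B)]. *)
Definition approximable (f : X -> nat) (A : set X) : Prop :=
  measurable A /\ forall r : R, 0 < r -> exists s B,
    local f s B /\ mass mu (symdiff A B) < r.

Lemma measurable_symdiff A B :
  measurable A -> measurable B -> measurable (symdiff A B).
Proof. by move=> mA mB; apply: measurableU; apply: measurableD. Qed.

Lemma symdiff_trans A B C : symdiff A C `<=` symdiff A B `|` symdiff B C.
Proof.
move=> x [[Ax Cx]|[Cx Ax]]; have [Bx|Bx] := pselect (B x).
- by right; left.
- by left; left.
- by left; right.
- by right; right.
Qed.

Section Approximation.
Context (f : X -> nat).
Hypothesis mf : measurable_fibers f.

Lemma mass_symdiff_trans A B C : measurable A -> measurable B -> measurable C ->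
  mass mu (symdiff A C) <= mass mu (symdiff A B) + mass mu (symdiff B C).
Proof.
move=> mA mB mC; apply: le_trans (massU _ _ _); try exact: measurable_symdiff.
apply: le_mass; last exact: symdiff_trans.
- exact: measurable_symdiff.
- by apply: measurableU; exact: measurable_symdiff.
Qed.

Lemma approximable_closed A : measurable A ->
  (forall r : R, 0 < r -> exists2 B, approximable f B & mass mu (symdiff A B) < r) ->
  approximable f A.
Proof.
move=> mA H; split => // r r0.
have [|B [mB aB] AB] := H (r / 2); first by lra.
have [|s [C [lC BC]]] := aB (r / 2); first by lra.
exists s, C; split => //; have mC := measurable_local mf lC.
by have := mass_symdiff_trans mA mB mC; lra.
Qed.

Lemma approximableU A B : approximable f A -> approximable f B ->
  approximable f (A `|` B).
Proof.
move=> [mA aA] [mB aB]; split => [|r r0]; first exact: measurableU.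
have [|s [A' [lA' AA']]] := aA (r / 2); first by lra.
have [|t [B' [lB' BB']]] := aB (r / 2); first by lra.
exists (s ++ t), (A' `|` B'); split.
  apply: (@local_comp2 _ _ _ _ _ A' B' or).
    by apply: local_sub lA' => x xs; rewrite mem_cat xs.
  by apply: local_sub lB' => x xs; rewrite mem_cat xs orbT.
have mA' := measurable_local mf lA'; have mB' := measurable_local mf lB'.
have mAA' := measurable_symdiff mA mA'; have mBB' := measurable_symdiff mB mB'.
suff : mass mu (symdiff (A `|` B) (A' `|` B')) <=
    mass mu (symdiff A A' `|` symdiff B B').
  by have := massU mu mAA' mBB'; lra.
apply: le_mass; try exact: measurableU.
  by apply: measurable_symdiff; exact: measurableU.
move=> x [[[Ax|Bx] /not_orP[nA' nB']]|[[Ax|Bx] /not_orP[nA' nB']]].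
- by left; left.
- by right; left.
- by left; right.
- by right; right.
Qed.

Lemma approximableC A : approximable f A -> approximable f (~` A).
Proof.
move=> [mA aA]; split => [|r r0]; first exact: measurableC.
have [s [B [lB AB]]] := aA r r0; exists s, (~` B); split.
  by move=> x y E; rewrite /setC /= (lB _ _ E).
suff -> : symdiff (~` A) (~` B) = symdiff A B by [].
apply/seteqP; split => x; rewrite /symdiff /setD /= ?notK.
  by move=> [[? ?]|[? ?]]; [right|left].
by move=> [[? ?]|[? ?]]; [right|left].
Qed.

Lemma approximable_transl k A : approximable f A -> approximable f (transl inv act k A).
Proof.
move=> [mA aA]; split => [|r r0]; first exact: measurable_act.
have [s [B [lB AB]]] := aA r r0; exists [seq mul k h | h <- s], (B \o act (inv k)).
split; first exact: local_transl.
have mB := measurable_local mf lB.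
by rewrite -(mass_act (inv k)) in AB => //; exact: measurable_symdiff.
Qed.

Lemma approximable_local s A : local f s A -> approximable f A.
Proof.
move=> lA; split => [|r r0]; first exact: measurable_local lA.
by exists s, A; split => //; rewrite /symdiff setDv setU0 /mass measure0.
Qed.

(** A countable union is approximated by its finite subunions, which [mass_tail] brings arbitrarily
    close. *)
Lemma sigma_algebra_approximable : sigma_algebra setT (approximable f).
Proof.
split.
- by apply: (@approximable_local [::]).
- by move=> A aA; rewrite setTD; exact: approximableC.
- move=> F aF; have mF i : measurable (F i) by case: (aF i).
  have mU : measurable (\bigcup_i F i) by exact: bigcupT_measurable.
  apply: approximable_closed => // r r0.
  have [n Hn] := mass_tail mu mF mU (@subset_refl _ _) r0.
  exists (\big[setU/set0]_(i < n) F i).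
    elim/big_ind: _ => //; last by move=> *; exact: approximableU.
    by apply: (@approximable_local [::]).
  rewrite /symdiff (_ : _ `\` \bigcup_i F i = set0) ?setU0//.
  by rewrite setD_eq0 -bigcup_mkord; exact: bigcup_subset.
Qed.

(** The approximable sets form an invariant sigma-algebra containing the atoms, hence contain
    [inv_sigma]; a null difference does not affect approximability. *)
Lemma approximable_generating A : generating inv act mu (fibers f) ->
  measurable A -> approximable f A.
Proof.
move=> gen mA; have [B iB AB] := gen A mA.
have aB : approximable f B.
  apply: iB; split; first split.
  - exact: sigma_algebra_approximable.
  - by move=> g B'; exact: approximable_transl.
  - move=> _ [i _ <-]; apply: (@approximable_local [:: e]) => x y [].
    by rewrite !act_inv_e => E; rewrite /fibers /preimage /= E.
apply: approximable_closed => // r r0; exists B => //.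
by rewrite /mass AB.
Qed.

(* Approximate the fibres [b = k], [k < N], by local sets [C k] and read off the first [k]
   with [x] in [C k]; [find] returns the default [N] if there is none. *)
Lemma local_approximation (b : X -> nat) (N : nat) (r : R) :
  generating inv act mu (fibers f) ->
  measurable_fibers b -> (forall x, (b x <= N)%N) -> 0 < r ->
  exists s (g : X -> nat), [/\ local f s g, (forall x, (g x <= N)%N) &
    mass mu [set x | g x != b x] < r].
Proof.
move=> gen mb bN r0.
(* Only [N] fibres are approximated; the denominator [N.+1] keeps the total error strictly below [r]
   and is nonzero for [N = 0]. *)
have r1 : 0 < r / N.+1%:R by rewrite divr_gt0.
have /choice[C HC] k : exists p : seq G * set X,
    local f p.1 p.2 /\ mass mu (symdiff (fibers b k) p.2) < r / N.+1%:R.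
  have [_ /(_ _ r1) [s [B [lB BB]]]] := approximable_generating gen (mb k).
  by exists (s, B).
have mC k : measurable (C k).2 by have [/(measurable_local mf)] := HC k.
pose g x := find (fun k => x \in (C k).2) (iota 0 N).
have lg : local f (flatten [seq (C k).1 | k <- iota 0 N]) g.
  move=> x y E; rewrite /g; apply: eq_in_find => k kN.
  apply/idP/idP; rewrite !inE; have [lC _] := HC k;
  by rewrite (@local_sub _ _ _ _ _ _ lC _ _ E) // => h hk; apply/flatten_mapP; exists k.
exists (flatten [seq (C k).1 | k <- iota 0 N]), g; split => //.
  by move=> x; rewrite -[X in (_ <= X)%N](size_iota 0); exact: find_size.
pose D k := symdiff (fibers b k) (C k).2.
have mD k : measurable (D k) by exact: measurable_symdiff.
have sub : [set x | g x != b x] `<=` \big[setU/set0]_(k <- iota 0 N) D k.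
  move=> x /= /eqP ngb; rewrite -bigcup_seq; apply: contrapT => H; apply: ngb.
  have CB k : (k < N)%N -> (x \in (C k).2) = (b x == k).
    move=> kN; apply/idP/eqP; rewrite inE => h; apply: contrapT => h'; apply: H; exists k;
      rewrite /= ?mem_iota //.
    - by right.
    - by left.
  have E : {in iota 0 N, (fun k => x \in (C k).2) =1 pred1 (b x)}.
    by move=> k; rewrite mem_iota add0n => /andP[_ kN]; rewrite CB//= eq_sym.
  rewrite /g (eq_in_find E) -/(index (b x) (iota 0 N)).
  have [bx|bx] := ltnP (b x) N; first by
    rewrite -{1}[b x]add0n -(nth_iota 0%N 0 bx) index_uniq ?iota_uniq ?size_iota.
  (* No index is hit: [find] returns the length [N], and [b x <= N] forces [b x = N]. *)
  rewrite memNindex ?size_iota; last by rewrite mem_iota; lia.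
  by apply/eqP; rewrite eqn_leq bx bN.
have mg : measurable [set x | g x != b x].
  apply: (@measurable_preimage_countable _ _ _ (fun x => (g x, b x)) [set p | p.1 != p.2]).
  by apply: measurable_fiber_pair => // t; exact: measurable_local_fiber lg.
apply: le_lt_trans (le_mass mu _ _ sub) _ => //; first exact: bigsetU_measurable.
apply: le_lt_trans (mass_bigsetU mu _ mD) _.
apply: (@le_lt_trans _ _ (\sum_(k <- iota 0 N) r / N.+1%:R)).
  by apply: ler_sum => k _; apply: ltW; have [] := HC k.
rewrite big_const_seq count_predT size_iota iter_addr_0 -[ltLHS]mulr_natr.
by rewrite mulrAC ltr_pdivrMr// ltr_pM2l// ltr_nat.
Qed.

End Approximation.
End Local.

(** * The approximating partition *)

Section Partitions.
Context (d : measure_display) (X : measurableType d) (R : realType).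
Variable mu : probability X R.

Lemma in_P_fibers alpha : in_P mu alpha ->
  exists2 a : X -> nat, measurable_fibers a & alpha = fibers a.
Proof.
move=> [ma ta ca _].
have /choice[a Ha] x : exists i, alpha i x.
  have [i _ ix] : (\bigcup_i alpha i) x by rewrite ca.
  by exists i.
have E : alpha = fibers a.
  apply/funext => i; apply/seteqP; split => x; last by move=> <-.
  move=> ix; apply: contrapT => /ta E.
  by have : (alpha (a x) `&` alpha i) x; [|rewrite E].
by exists a => // i; rewrite -E.
Qed.

Lemma fibers_in_P a : measurable_fibers a -> (entropy mu (fibers a) < +oo)%E ->
  in_P mu (fibers a).
Proof.
move=> ma Ea; split => //; last exact: bigcup_fibers.
by move=> i j ij; rewrite -subset0 => x [/= ai aj]; apply: ij; rewrite -ai.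
Qed.

(** Turns a bound on conditional entropy into finiteness of entropy. The term at [j = 0], where the
    fibre is the whole space, is already the entropy term. *)
Lemma entropy_le_cond_trivial a : measurable_fibers a ->
  (entropy mu (fibers a) <= cond_entropy mu (fibers a) (fibers (fun=> 0%N)))%E.
Proof.
move=> ma.
have m0 : measurable_fibers (fun=> 0%N : nat) (X := X).
  move=> i; rewrite /fibers; have [->|i0] := eqVneq i 0%N.
    by rewrite (_ : _ @^-1` _ = setT)//; apply/seteqP; split.
  rewrite (_ : _ @^-1` _ = set0)//; apply/seteqP; split => // x /= E.
  by rewrite -E eqxx in i0.
have f0 : fibers (fun=> 0%N) 0%N = [set: X] by apply/seteqP; split.
have etaE i : Defs.eta (mass mu (fibers a i)) =
    cond_term mu (fibers a i) (fibers (fun=> 0%N) 0%N).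
  rewrite f0 /cond_term /Defs.eta setIT probability_setT /= ln1 sub0r.
  by rewrite -/(mass mu _); case: eqP => // _; rewrite mulrN.
apply: lee_nneseries => [i _ _|i _].
  by rewrite -/(mass mu _) etaE lee_fin cond_term_ge0.
rewrite -/(mass mu _) etaE.
have := @nneseries_lim_ge R
  (fun j => (cond_term mu (fibers a i) (fibers (fun=> 0%N) j))%:E) xpredT 0%N 1%N.
rewrite big_nat1; apply => j _ _.
by rewrite lee_fin cond_term_ge0.
Qed.

Lemma measurable_neq (f g : X -> nat) : measurable_fibers f -> measurable_fibers g ->
  measurable [set x | f x != g x].
Proof. by move=> mf mg; exact: (measurable_rel2 (fun i j => i != j)). Qed.

Lemma mass_neq_trans (f g h : X -> nat) :
  measurable_fibers f -> measurable_fibers g -> measurable_fibers h ->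
  mass mu [set x | f x != h x] <=
  mass mu [set x | f x != g x] + mass mu [set x | g x != h x].
Proof.
move=> mf mg mh; apply: le_trans (massU _ _ _); try exact: measurable_neq.
apply: le_mass; first exact: measurable_neq.
  by apply: measurableU; exact: measurable_neq.
move=> x /= fh; have [E|fg] := eqVneq (f x) (g x); last by left.
by right; rewrite /= -E.
Qed.

Lemma measurable_fibers_minn (f : X -> nat) N : measurable_fibers f ->
  measurable_fibers (fun x => minn (f x) N).
Proof.
by move=> mf i; exact: (measurable_rel2 (fun j _ => minn j N = i) mf mf).
Qed.

(** Truncation produces the bounded functions that [local_approximation] accepts, at the price of a
    small tail. *)
Lemma mass_neq_minn (f : X -> nat) (r : R) : measurable_fibers f -> 0 < r ->
  exists N, mass mu [set x | minn (f x) N != f x] < r.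
Proof.
move=> mf r0.
have [|N HN] := @mass_tail _ _ _ mu (fibers f) setT r mf (@measurableT _ _) _ r0.
  by rewrite bigcup_fibers.
exists N; apply: le_lt_trans HN; apply: le_mass.
- by apply: measurable_neq => //; exact: measurable_fibers_minn.
- by apply: measurableD => //; exact: bigsetU_measurable.
move=> x /= fN; split => //; rewrite -bigcup_mkord => -[i /= iN fi].
by move/eqP: fN; apply; apply/minn_idPl; rewrite fi ltnW.
Qed.

End Partitions.

(** * Refinement by finite joins and stability of the factor map *)

Section Refinement.
Context (G : countType) (mul : G -> G -> G) (inv : G -> G) (e : G).
Context (R : realType) (d : measure_display) (X : measurableType d).
Context (mu : probability X R) (act : G -> X -> X).
Hypothesis HG : is_group mul inv e.
Hypothesis Hact : is_mp_action mul e mu act.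

(** Points of one atom of the join share their [s]-itinerary, so [b] is constant there; an empty
    atom lies in every fibre. *)
Lemma refined_by_join_local (a b : X -> nat) (s : seq G) (F : set G) :
  [set` s] `<=` F -> local inv act a s b ->
  refined_by_join inv act mu (fibers b) (fibers a) F.
Proof.
move=> sF lb c; set I := \bigcap_(g in F) _.
have [I0|/set0P[x Ix]] := eqVneq I set0; first by exists 0%N; rewrite I0 set0D measure0.
exists (b x); rewrite (_ : I `\` _ = set0) ?measure0//.
rewrite setD_eq0 => y Iy; apply: lb; apply/eq_in_map => h /sF Fh.
by have := Ix h Fh; have := Iy h Fh; rewrite /transl /fibers /= => -> ->.
Qed.

(** An error requires [g] and [b] to differ at [act (inv h) x] for some [h] in [s]. By invariance
    each of these events has the same mass. *)
Lemma mass_neq_factor (b f g : X -> nat) (s : seq G) :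
  measurable_fibers b -> measurable_fibers g -> local inv act b s f ->
  mass mu [set x | itinerary_factor inv act b s f (itinerary inv act g s x) != f x] <=
  (size s)%:R * mass mu [set x | g x != b x].
Proof.
move=> mb mg lf.
have mgb := measurable_neq mg mb.
have mf : measurable_fibers f by move=> i; exact: (measurable_local_fiber Hact i mb lf).
have lf' : local inv act g s (fun x => itinerary_factor inv act b s f (itinerary inv act g s x)).
  by move=> x y ->.
pose D h := act (inv h) @^-1` [set x | g x != b x].
have mD h : measurable (D h) by exact: (measurable_act Hact).
apply: (@le_trans _ _ (mass mu (\big[setU/set0]_(h <- s) D h))).
  apply: le_mass.
  - apply: measurable_neq => // i.
    exact: (measurable_local_fiber Hact i mg lf').
  - exact: bigsetU_measurable.
  - move=> x /= /eqP nf; rewrite -bigcup_seq; apply: contrapT => H; apply: nf.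
    rewrite -[RHS](itinerary_factorP lf); congr itinerary_factor; apply/eq_in_map => h hs.
    by apply: contrapT => /eqP ngb; apply: H; exists h.
apply: le_trans (mass_bigsetU mu _ mD) _.
rewrite (eq_bigr (fun=> mass mu [set x | g x != b x])); last first.
  by move=> h _; exact: (mass_act Hact).
by rewrite big_const_seq count_predT iter_addr_0 mulr_natl.
Qed.

End Refinement.

(** * Choice of the constants and estimate of the Rohlin distance *)

Theorem theorem4p6 (G : countType) (mul : G -> G -> G) (inv : G -> G) (e : G)
    (HG : is_group mul inv e)
    (R : realType) (d : measure_display) (X : measurableType d)
    (mu : probability X R) (act : G -> X -> X) (Hact : is_mp_action mul e mu act)
    (S : set G) (HS : generates mul inv e S)
    (alpha beta : nat -> set X)
    (Ha : in_P mu alpha) (Hb : in_P mu beta)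
    (Hga : generating inv act mu alpha) (Hgb : generating inv act mu beta)
    (eps : R) (Heps : 0 < eps) :
  exists alpha' : nat -> set X,
    [/\ in_P mu alpha',
        S_equivalent mul inv e act mu S alpha' alpha &
        (rohlin_dist mu alpha' beta < eps%:E)%E].
Proof.
have [a ma alphaE] := in_P_fibers Ha; have [b mb betaE] := in_P_fibers Hb.
have [_ _ _] := Ha; have [_ _ _] := Hb; rewrite {}alphaE {}betaE in Ha Hb Hga Hgb *.
move=> Eb Ea.
(* Chosen so that a correct guess costs [- ln (1 - c) = eps / 8]. *)
pose c : R := 1 - expR (- (eps / 8)).
have cE : - ln (1 - c) = eps / 8 by rewrite /c opprB addrC subrK expRK opprK.
have c01 : 0 < c < 1.
  have e0 := expR_gt0 (- (eps / 8)).
  have e1 : expR (- (eps / 8)) < 1 by rewrite -expR0 ltr_expR oppr_lt0 divr_gt0.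
  by rewrite /c subr_gt0 e1 ltrBlDr ltrDl.
have lc : 0 <= - ln c by rewrite oppr_ge0 ln_le0// ltW//; case/andP: c01.
have eps8 : 0 < eps / 8 by lra.
have [da da0 Hda] := integral_info_small ma Ea lc eps8.
have [db db0 Hdb] := integral_info_small mb Eb lc eps8.
(* The final disagreement of [f'] with [a] has three sources, each allotted a third of [da]:
   truncating [a], approximating it by [f], and replacing [b] by [g]. *)
have da3 : 0 < da / 3 by lra.
have [n an] := mass_neq_minn mu ma da3.
have [s [f [lf _ fan]]] := local_approximation HG Hact mb Hgb
  (measurable_fibers_minn n ma) (fun x => geq_minr (a x) n) da3.
have mf : measurable_fibers f by move=> i; exact: (measurable_local_fiber Hact i mb lf).
(* The bound [db] serves the prediction of [b] by [g]; the other one absorbs the factor [size s] of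
   [mass_neq_factor]. *)
pose d3 := Num.min db (da / 3 / (size s).+1%:R).
have d30 : 0 < d3 by rewrite lt_min db0 divr_gt0.
have d32 : 0 < d3 / 2 by lra.
have [N bN] := mass_neq_minn mu mb d32.
pose K : R := - ln c + ln N.+1%:R.
have K0 : 0 <= K by rewrite addr_ge0// ln_ge0// ler1n.
(* A wrong remainder costs [K], which depends on [N]; so the truncation level is fixed before the
   accuracy of [g]. *)
pose d2 := Num.min (d3 / 2) (eps / 8 / (K + 1)).
have d20 : 0 < d2 by rewrite lt_min d32 divr_gt0//; lra.
have [L [g [lg gN gbN]]] := local_approximation HG Hact ma Hga
  (measurable_fibers_minn N mb) (fun x => geq_minr (b x) N) d20.
have mg : measurable_fibers g by move=> i; exact: (measurable_local_fiber Hact i ma lg).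
have gb : mass mu [set x | g x != b x] < d3.
  have := mass_neq_trans mu mg (measurable_fibers_minn N mb) mb.
  have : d2 <= d3 / 2 by rewrite ge_min lexx.
  lra.
pose f' x := itinerary_factor inv act b s f (itinerary inv act g s x).
have lf' : local inv act g s f' by move=> x y E; rewrite /f' E.
have mf' : measurable_fibers f' by move=> i; exact: (measurable_local_fiber Hact i mg lf').
have f'a : mass mu [set x | f' x != a x] < da.
  have man := measurable_fibers_minn n ma.
  have := mass_neq_trans mu mf' mf ma; have := mass_neq_trans mu mf man ma.
  have := mass_neq_factor Hact mb mg lf; rewrite -/(f' _).
  have : (size s)%:R * mass mu [set x | g x != b x] <= da / 3.
    apply: (@le_trans _ _ ((size s).+1%:R * d3)).
      by apply: ler_pM; rewrite ?mass_ge0// ?ler_nat// ltW.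
    by rewrite mulrC -ler_pdivlMr// ge_min lexx orbT.
  lra.
pose xi x := if f' x == a x then 0%N else (a x).+1.
(* The pair [(g, xi)] as one number: [g x <= N] is the remainder modulo [N.+1], and [xi x] is the
   quotient. *)
pose a' x := (xi x * N.+1 + g x)%N.
have a'mod x : (a' x %% N.+1)%N = g x by rewrite /a' modnMDl modn_small// ltnS.
have a'div x : (a' x %/ N.+1)%N = xi x.
  by rewrite /a' divnMDl// divn_small ?addn0// ltnS.
(* The three pieces are the windows of [g], of [f'] and of [a] itself. *)
pose L' := L ++ [seq mul h' h | h' <- s, h <- L] ++ [:: e].
have la' : local inv act a L' a'.
  have l1 : local inv act a L' g by apply: local_sub lg => h hL; rewrite mem_cat hL.
  have l2 : local inv act a L' f'.
    apply: local_sub (local_bind HG Hact lg lf') => h hL.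
    by rewrite !mem_cat hL orbT.
  have l3 : local inv act a L' a.
    apply: local_sub (local_self HG Hact (a := a)) => h hL.
    by rewrite !mem_cat hL !orbT.
  by move=> x y E; rewrite /a' /xi (l1 x y E) (l2 x y E) (l3 x y E).
have ma' : measurable_fibers a' by move=> i; exact: (measurable_local_fiber Hact i ma la').
have la : local inv act a' (s ++ [:: e]) a.
  move=> x y E.
  have fE : f' x = f' y.
    apply: lf'; apply/eq_in_map => h hs.
    have /eq_in_map /(_ h) := E; rewrite mem_cat hs => /(_ isT) E'.
    by rewrite -!a'mod E'.
  have xiE : xi x = xi y.
    rewrite -!a'div; congr (_ %/ _)%N; apply: (local_self HG Hact).
    by apply: itinerary_sub E => h hs; rewrite mem_cat hs orbT.
  by move: xiE; rewrite /xi fE; case: eqP => [<-|_]; case: eqP => // _ [].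
have mneq : measurable [set x | (a' x %/ N.+1)%N != 0%N].
  exact: (measurable_rel2 (fun i _ => (i %/ N.+1)%N != 0%N) ma' ma').
have xia : mass mu [set x | (a' x %/ N.+1)%N != 0%N] < da.
  rewrite (_ : [set x | _] = [set x | f' x != a x])//.
  by apply/seteqP; split => x /=; rewrite a'div /xi; case: (f' x == a x).
have a'a x : (a' x %/ N.+1)%N != 0%N -> (a' x %/ N.+1)%N = (a x).+1.
  by rewrite a'div /xi; case: (f' x == a x).
(* Used twice: a constant [h] gives finite entropy of [a'], and [h = b] bounds the first half of the
   distance. *)
have code (h : X -> nat) (mh : measurable_fibers h) :=
  @cond_entropy_code _ _ _ mu a' h a (fun j => minn j N) N c ma' mh ma c01
    (fun j => geq_minr j N) a'a.
have Hxi := Hda _ mneq xia.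
exists (fibers a'); split.
- apply: fibers_in_P => //; apply: le_lt_trans (entropy_le_cond_trivial mu ma') _.
  apply: le_lt_trans (code _ _) _.
    by move=> i; exact: (measurable_rel2 (fun _ _ => 0%N = i) ma ma).
  by rewrite -EFinD lte_add_pinfty ?ltry// (lt_trans Hxi) ?ltry.
- have [F1 [fF1 cF1 F1e sF1]] := S_connected_hull L' HG HS.
  have [F2 [fF2 cF2 F2e sF2]] := S_connected_hull (s ++ [:: e]) HG HS.
  exists F1, F2; split => //.
  + exact: refined_by_join_local la'.
  + exact: refined_by_join_local la.
(* Conversely, the remainder of [a'], which is [g], predicts [b]. *)
have predict := @cond_entropy_predict _ _ _ mu b a' (fun i => i %% N.+1)%N c mb ma' c01.
have bneq : [set x | b x != (a' x %% N.+1)%N] = [set x | g x != b x].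
  by apply/seteqP; split => x /=; rewrite a'mod eq_sym.
rewrite bneq in predict.
have mneqb : measurable [set x | g x != b x] by exact: measurable_neq.
have gdb : mass mu [set x | g x != b x] < db.
  by apply: lt_le_trans gb _; rewrite ge_min lexx.
have Hgb' := Hdb _ mneqb gdb.
have {}code := code b mb.
have gneq : [set x | (a' x %% N.+1)%N != minn (b x) N] = [set x | g x != minn (b x) N].
  by apply/seteqP; split => x /=; rewrite a'mod.
rewrite gneq -/K cE in code; rewrite cE in predict.
have Km : K * mass mu [set x | g x != minn (b x) N] <= eps / 8.
  have h1 : d2 <= eps / 8 / (K + 1) by rewrite ge_min lexx orbT.
  apply: (@le_trans _ _ ((K + 1) * (eps / 8 / (K + 1)))).
    by apply: ler_pM; rewrite ?mass_ge0//; lra.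
  by rewrite mulrC divfK//; lra.
(* Four costs of at most [eps / 8]: the base cost of each of the two guesses, a wrong remainder, and
   a nonzero quotient, the last one strictly smaller. *)
have lt1 : (cond_entropy mu (fibers a') (fibers b) < (eps / 2)%:E)%E.
  apply: le_lt_trans code _.
  apply: (@lt_le_trans _ _ ((eps / 8 + eps / 8)%:E +
    (K * mass mu [set x | g x != minn (b x) N])%:E + (eps / 8)%:E)%E).
    by rewrite -EFinD lteD2lE.
  by rewrite -!EFinD lee_fin; lra.
have lt2 : (cond_entropy mu (fibers b) (fibers a') < (eps / 2)%:E)%E.
  apply: le_lt_trans predict _.
  apply: (@lt_le_trans _ _ ((eps / 8)%:E + (eps / 8)%:E)%E).
    by rewrite lteD2lE.
  by rewrite -!EFinD lee_fin; lra.
by rewrite /rohlin_dist [eps]splitr EFinD; exact: lteD.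
Qed.
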